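(* Let $n$ be an integer with $n\equiv 0\pmod 4$ and let $j\ge1$ be an integer. Then the Conway polynomial, reduced modulo $2$, of the generalized Fibonacci link $\mathcal{F}_j^{(n)}=\mathcal{C}(\underbrace{n,n,\ldots,n}_{j})$ is $0$ if $j$ is odd, and $1$ if $j$ is even.
   Context: Rational links: $\mathcal{C}(a_1,\ldots,a_m)$ denotes the rational (two-bridge) link with Conway normal form $(a_1,\ldots,a_m)$: its standard diagram consists of $m$ consecutive twist regions, the $i$-th having $|a_i|$ crossings, where for odd $i$ right twists count as positive and for even $i$ right twists count as negative (so that the diagram is alternating when all $a_i$ have the same sign). Its Schubert fraction is $\frac{\alpha}{\beta}=[a_1,\ldots,a_m]=a_1+\cfrac{1}{a_2+\cfrac{1}{\cdots+\cfrac{1}{a_m}}}$. The link is a knot if $\alpha$ is odd and has two components if $\alpha$ is even. Orientation convention (needed only for two-component links): a link $\mathcal{C}(2a_1,\ldots,2a_m)$ with all entries even is oriented so that the two strands in each twist region are antiparallel. The Conway polynomial is normalized by $\nabla=1$ for the unknot and the skein relation $\nabla_{L_+}-\nabla_{L_-}=z\nabla_{L_0}$ (signs are irrelevant modulo 2). *)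

(* Defs.v *)
From mathcomp Require Import all_boot all_order all_algebra.

Set Implicit Arguments.
Unset Strict Implicit.
Unset Printing Implicit Defensive.

Import GRing.Theory.

(* Oriented link diagrams in the plane, generic with respect to height and    *)
(* read from bottom to top.  Just below each critical point or crossing the   *)
(* diagram meets a horizontal line in finitely many strands, numbered from    *)
(* the left starting at 0.  The event (i, g) is the elementary piece g acting *)
(* on the strands i, i+1 (for a Cup: creating them), all other strands being  *)
(* vertical.                                                                  *)
(*   Cup o   : a local minimum; its left branch points upwards iff o.         *)
(*   Cap     : a local maximum.                                               *)
(*   Cross s : a crossing; the over-strand is the one running from bottom     *)
(*             left to top right if s (a right-handed half twist of two       *)
(*             vertical strands), the other one if ~~ s (left-handed).        *)
Inductive piece := Cup of bool | Cap | Cross of bool.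

Definition diagram := seq (nat * piece).

(* The orientations of the strands at a given height, true meaning upwards.   *)
Definition level := seq bool.

Definition apply_event (l : level) (e : nat * piece) : option level :=
  let: (i, g) := e in
  match g, drop i l with
  | Cup o, r => if i <= size l then Some (take i l ++ [:: o, ~~ o & r])
                else None
  | Cap, x :: y :: r => if x != y then Some (take i l ++ r) else None
  | Cross _, x :: y :: r => Some (take i l ++ [:: y, x & r])
  | _, _ => None
  end.

Definition run (D : diagram) : option level :=
  foldl (fun l e => obind (apply_event^~ e) l) (Some [::]) D.

(* D is a closed, coherently oriented diagram. *)
Definition is_link (D : diagram) : Prop := run D = Some [::].

Definition strands_in (g : piece) : nat := if g is Cup _ then 0 else 2.
Definition strands_out (g : piece) : nat := if g is Cap then 0 else 2.

(* Generating moves between height-generic diagrams: together they generate   *)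
(* ambient isotopy of links.  The first five constructors are planar          *)
(* isotopies, the other ones are the Reidemeister moves.                      *)
Inductive local_move : diagram -> diagram -> Prop :=
| exchange_heights i d g h :
    local_move [:: (i, g); (i + strands_out g + d, h)]
               [:: (i + strands_in g + d, h); (i, g)]
| straighten_left i o : local_move [:: (i.+1, Cup o); (i, Cap)] [::]
| straighten_right i o : local_move [:: (i, Cup o); (i.+1, Cap)] [::]
| swing_cap i s :
    local_move [:: (i, Cross s); (i.+1, Cap)]
               [:: (i.+1, Cross (~~ s)); (i, Cap)]
| swing_cup i o s :
    local_move [:: (i, Cup o); (i.+1, Cross s)]
               [:: (i.+1, Cup o); (i, Cross (~~ s))]
| reidemeister1_cap i s : local_move [:: (i, Cross s); (i, Cap)] [:: (i, Cap)]
| reidemeister1_cup i o s :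
    local_move [:: (i, Cup o); (i, Cross s)] [:: (i, Cup (~~ o))]
| reidemeister2 i s : local_move [:: (i, Cross s); (i, Cross (~~ s))] [::]
| reidemeister3 i s :
    local_move [:: (i, Cross s); (i.+1, Cross s); (i, Cross s)]
               [:: (i.+1, Cross s); (i, Cross s); (i.+1, Cross s)].

(* The oriented smoothing of a crossing of the strands i, i+1, which below    *)
(* the crossing have orientations x and y.                                    *)
Definition smoothing (i : nat) (x y : bool) : diagram :=
  if x == y then [::] else [:: (i, Cap); (i, Cup y)].

(* The Conway polynomial.  In the skein relation a crossing of two parallel   *)
(* strands is positive iff it is right-handed; for antiparallel strands it is *)
(* positive iff it is left-handed.  Hence Cross (x == y) is the positive      *)
(* crossing, Cross (x != y) the negative one, and 'X stands for z.            *)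
Record is_conway_polynomial (nabla : diagram -> {poly int}) : Prop := {
  conway_isotopy : forall u v D D' : diagram,
    local_move D D' -> is_link (u ++ D ++ v) -> is_link (u ++ D' ++ v) ->
    nabla (u ++ D ++ v) = nabla (u ++ D' ++ v);
  conway_unknot : forall o : bool, nabla [:: (0, Cup o); (0, Cap)] = 1%R;
  conway_skein : forall (u v : diagram) (l r : level) (x y : bool),
    run u = Some (l ++ [:: x, y & r]) ->
    is_link (u ++ (size l, Cross (x == y)) :: v) ->
    (nabla (u ++ (size l, Cross (x == y)) :: v)
       - nabla (u ++ (size l, Cross (x != y)) :: v))%R
    = ('X * nabla (u ++ smoothing (size l) x y ++ v))%R
}.

(* a right-handed half twists of the strands i, i+1, left-handed if a < 0.    *)
Definition twist (i : nat) (a : int) : diagram :=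
  nseq `|a| (i, Cross (0 <= a)%R).

(* The twist regions of C(a_1, ..., a_m): the i-th one is in the middle for   *)
(* odd i, where right twists are positive, and on the left for even i, where  *)
(* right twists are negative.                                                 *)
Fixpoint twist_regions (odd_index : bool) (a : seq int) : diagram :=
  if a is x :: a' then
    (if odd_index then twist 1 x else twist 0 (- x)%R)
      ++ twist_regions (~~ odd_index) a'
  else [::].

(* The standard diagram of C(a_1, ..., a_m), as a 4-plat; o1 and o2 are the   *)
(* orientations at its two minima, which determine the whole orientation.     *)
(* The maxima join the strands 0-1 and 2-3 if m is odd, 1-2 and 0-3 if m is   *)
(* even.                                                                      *)
Definition rational_link (o1 o2 : bool) (a : seq int) : diagram :=
  [:: (0, Cup o1); (2, Cup o2)] ++ twist_regions true a
    ++ (if odd (size a) then [:: (0, Cap); (0, Cap)]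
        else [:: (1, Cap); (0, Cap)]).

Definition fibonacci_link (o1 o2 : bool) (n : int) (j : nat) : diagram :=
  rational_link o1 o2 (nseq j n).

(* The two strands are antiparallel at every crossing, hence in every twist   *)
(* region.                                                                    *)
Definition antiparallel (D : diagram) : Prop :=
  forall (u v : diagram) (l r : level) (x y s : bool),
    D = u ++ (size l, Cross s) :: v ->
    run u = Some (l ++ [:: x, y & r]) -> x != y.

Lemma foldl_run_none (D : diagram) :
  foldl (fun l e => obind (apply_event^~ e) l) None D = None.
Proof. by elim: D. Qed.

(* If all entries are even, then o1 = o2 is an antiparallel orientation. *)
Lemma rational_link_even (o : bool) (a : seq int) :
  all (fun x : int => ~~ odd `|x|) a ->
  is_link (rational_link o o a) /\ antiparallel (rational_link o o a).
Proof.
pose f := fun (l : option level) e => obind (apply_event^~ e) l.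
pose ok (l : level) (D : diagram) := forall u v l' r x y s,
  D = u ++ (size l', Cross s) :: v ->
  foldl f (Some l) u = Some (l' ++ [:: x, y & r]) -> x != y.
have ok_cons l g D m : apply_event l g = Some m -> ok m D ->
    (if g is (i, Cross _) then nth true l i != nth true l i.+1 else true) ->
    ok l (g :: D).
  move=> Em okm hg [|g' u] v l' r x y s /= [].
    move=> Eg _ [El]; move: hg; rewrite Eg El.
    by rewrite !nth_cat ltnn subnn ltnNge leqnSn subSnn.
  by move=> <- ED; rewrite Em; exact: (okm _ _ _ _ _ _ _ ED).
pose L : level := [:: o; ~~ o; o; ~~ o].
have tw i x D : i < 2 -> ~~ odd `|x| -> ok L D -> ok L (twist i x ++ D).
  rewrite /twist; move: (0 <= x)%R => s i2 /even_halfK <- okD.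
  elim: `|x|./2 => [//|k IHk]; rewrite doubleS /=.
  have [|] : i = 0 \/ i = 1 by case: i i2 {IHk} => [|[|]]; auto.
    move=> i0; rewrite i0 in IHk *.
    apply: (ok_cons _ _ _ [:: ~~ o; o; o; ~~ o]) => //;
      last by rewrite /L; case: (o).
    by apply: (ok_cons _ _ _ L) => //; rewrite /L; case: (o).
  move=> i1; rewrite i1 in IHk *.
  apply: (ok_cons _ _ _ [:: o; o; ~~ o; ~~ o]) => //;
      last by rewrite /L; case: (o).
  by apply: (ok_cons _ _ _ L) => //; rewrite /L; case: (o).
have twr i x : i < 2 -> ~~ odd `|x| ->
    foldl f (Some L) (twist i x) = Some L.
  move=> i2; rewrite /twist; move: (0 <= x)%R => s.
  move=> /even_halfK <-; move: `|x|./2 => n.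
  by case: i i2 => [|[|i]] // _; elim: n => [//|k IHk]; rewrite doubleS.
have absN (x : int) : `|(- x)%R|%N = `|x|%N by case: x => [[|n]|n].
move=> ha.
have regions D b : ok L D -> foldl f (Some L) D = Some [::] ->
    ok L (twist_regions b a ++ D) /\
    foldl f (Some L) (twist_regions b a ++ D) = Some [::].
  move=> okD rD; elim: a b ha => [|x a IHa] b //= /andP[hx /IHa{}IHa].
  have [IH1 IH2] := IHa (~~ b).
  have hx' : ~~ odd `|(- x)%R| by rewrite absN.
  by case: b IH1 IH2 => IH1 IH2; rewrite -catA foldl_cat twr //;
    split => //; apply: tw.
set caps : diagram := if odd (size a) then [:: (0, Cap); (0, Cap)]
                      else [:: (1, Cap); (0, Cap)].
have [] := regions caps true.
- rewrite /caps; case: (odd _) => [] [|? [|? [|? u]]] v l' r x y s;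
  by move=> E; inversion E.
- by rewrite /caps /L; case: (odd _); case: (o).
move=> ok1 run1; split.
  exact: run1.
have : ok [::] (rational_link o o a); last exact.
apply: (ok_cons _ _ _ [:: o; ~~ o]) => //.
exact: (ok_cons _ _ _ L).
Qed.

(* Main.v *)
Require Import Defs.
From mathcomp Require Import all_boot all_order all_algebra.

(* Undoing a full antiparallel twist changes the Conway polynomial by z times *)
(* that of the smoothed link, in which the rest of the twist region           *)
(* untwists by Reidemeister I; so this term does not depend on the number of  *)
(* crossings.  A region of 4k crossings contributes it 2k times, that is, 0   *)
(* modulo 2.  Hence every entry may be replaced by 0, and C(0, ..., 0) is the *)
(* two-component unlink for an odd number of entries, the unknot for an even  *)
(* number.                                                                    *)

Set Implicit Arguments.
Unset Strict Implicit.
Unset Printing Implicit Defensive.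

Import GRing.Theory.

(** The skein step is [conway2_full_twist]; applying it twice gives [conway2_twist4], which deletes
    four crossings. An even twist region returns its strands to their places, so the orientations
    seen by the next region are unchanged and [conway2_twist_regions] deletes the regions one after
    another. What remains is evaluated by [conway_unlink] and [conway_unknot_bent]. The orientation
    convention enters as [o1 = o2], which makes all twisted strands antiparallel. *)

Definition run_from (l : option level) (D : diagram) : option level :=
  foldl (fun l e => obind (apply_event^~ e) l) l D.

Lemma run_cat (u v : diagram) : run (u ++ v) = run_from (run u) v.
Proof. exact: foldl_cat. Qed.

Lemma run_from_cat (l : option level) (u v : diagram) :
  run_from l (u ++ v) = run_from (run_from l u) v.
Proof. exact: foldl_cat. Qed.

Lemma is_link_subst (u v D D' : diagram) :
  run_from (run u) D = run_from (run u) D' ->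
  is_link (u ++ D ++ v) -> is_link (u ++ D' ++ v).
Proof. by rewrite /is_link !run_cat !run_from_cat => ->. Qed.

Lemma run_from_nseq_cross (l r : level) (x y s : bool) (m : nat) :
  run_from (Some (l ++ [:: x, y & r])) (nseq m (size l, Cross s))
  = Some (l ++ if odd m then [:: y, x & r] else [:: x, y & r]).
Proof.
elim: m x y => [//|m IHm] x y.
by rewrite /= drop_size_cat // take_size_cat // [LHS]IHm; case: (odd m).
Qed.

(** Each crossing swaps the two oppositely oriented branches of the minimum, so only the parity of
    [m] matters. *)
Lemma run_from_cup_cross (l : level) (i m : nat) (o s : bool) :
  (i <= size l) ->
  run_from (Some l) ((i, Cup o) :: nseq m (i, Cross s))
  = run_from (Some l) [:: (i, Cup (o (+) odd m))].
Proof.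
move=> il; rewrite /= il.
have si : size (take i l) = i by rewrite size_takel.
rewrite -[in nseq _ _]si [LHS]run_from_nseq_cross.
by case: (odd m); rewrite ?addbT ?addbF ?negbK.
Qed.

Section ConwayPolynomial.

Variables (nabla : diagram -> {poly int}).
Hypothesis nabla_conway : is_conway_polynomial nabla.

Lemma conway_move (u v D D' : diagram) :
  local_move D D' -> run_from (run u) D = run_from (run u) D' ->
  is_link (u ++ D ++ v) -> nabla (u ++ D ++ v) = nabla (u ++ D' ++ v).
Proof.
move=> mv E lk; apply: (conway_isotopy nabla_conway mv lk).
exact: is_link_subst E lk.
Qed.

Lemma conway_cup_cross (u v : diagram) (l : level) (i m : nat) (o s : bool) :
  run u = Some l -> (i <= size l) ->
  is_link (u ++ ((i, Cup o) :: nseq m (i, Cross s)) ++ v) ->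
  nabla (u ++ ((i, Cup o) :: nseq m (i, Cross s)) ++ v)
  = nabla (u ++ (i, Cup (o (+) odd m)) :: v).
Proof.
move=> ru il; elim: m o => [|m IHm] o lk; first by rewrite addbF.
have E : run_from (run u) [:: (i, Cup o); (i, Cross s)]
         = run_from (run u) [:: (i, Cup (~~ o))].
  by rewrite ru (@run_from_cup_cross _ _ 1) // addbT.
have lk' := is_link_subst (v := nseq m (i, Cross s) ++ v) E lk.
rewrite [LHS](conway_move (v := nseq m (i, Cross s) ++ v)
  (reidemeister1_cup i o s) E lk).
by rewrite [LHS]IHm //= addbN addNb.
Qed.

Definition conway2 (D : diagram) : {poly 'F_2} :=
  map_poly (intr : int -> 'F_2) (nabla D).

Lemma poly_F2_addrr (p : {poly 'F_2}) : (p + p = 0)%R.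
Proof. by apply/polyP => i; rewrite coefD coef0; exact/addrr_pchar2/pchar_Fp. Qed.

(** Modulo 2 the sign in the skein relation disappears, so the positive and the negative crossing
    play symmetric roles. *)
Lemma conway2_skein (u v : diagram) (l r : level) (x s : bool) :
  run u = Some (l ++ [:: x, ~~ x & r]) ->
  is_link (u ++ (size l, Cross s) :: v) ->
  conway2 (u ++ (size l, Cross s) :: v)
  = (conway2 (u ++ (size l, Cross (~~ s)) :: v)
     + 'X * conway2 (u ++ [:: (size l, Cap), (size l, Cup (~~ x)) & v]))%R.
Proof.
move=> ru lk.
(* [conway_skein] asks for the diagram with the positive crossing, which is [Cross false] for
   antiparallel strands. *)
have lkF : is_link (u ++ (size l, Cross false) :: v).
  by apply: (@is_link_subst _ _ [:: (size l, Cross s)] [:: _]) lk.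
have := conway_skein nabla_conway (v := v) ru.
have -> : (x == ~~ x) = false by case: (x).
rewrite /smoothing; have -> : (x == ~~ x) = false by case: (x).
move=> /(_ lkF) /(congr1 (map_poly (intr : int -> 'F_2))).
rewrite rmorphB rmorphM /= map_polyX -/(conway2 _) -/(conway2 _) -/(conway2 _).
move/eqP; rewrite subr_eq => /eqP E.
case: s {lk} => /=; rewrite E addrC //.
by rewrite addrA poly_F2_addrr add0r.
Qed.

(** Apply the skein relation to the lowest crossing. Once changed, it cancels with the next one by
    Reidemeister II. Once smoothed, it leaves [m.+1] crossings on a new minimum; Reidemeister I
    removes them, and since [m.+1] is odd the orientation [~~ x] of the minimum becomes [x]. *)
Lemma conway2_full_twist (u v : diagram) (l r : level) (x s : bool) (m : nat) :
  run u = Some (l ++ [:: x, ~~ x & r]) -> ~~ odd m ->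
  is_link (u ++ nseq m.+2 (size l, Cross s) ++ v) ->
  conway2 (u ++ nseq m.+2 (size l, Cross s) ++ v)
  = (conway2 (u ++ nseq m (size l, Cross s) ++ v)
     + 'X * conway2 (u ++ [:: (size l, Cap), (size l, Cup x) & v]))%R.
Proof.
move=> ru em lk; set i := size l; set c := (i, Cross s).
rewrite [LHS](conway2_skein (v := nseq m.+1 c ++ v) ru lk); congr (_ + 'X * _)%R.
- have lk' : is_link (u ++ [:: (i, Cross (~~ s)); c] ++ nseq m c ++ v).
    apply: (@is_link_subst _ _ [:: c; c]) lk.
    by rewrite ru /= !(drop_size_cat, take_size_cat).
  rewrite /conway2; congr (map_poly _ _).
  apply: (@conway_move _ _ [:: (i, Cross (~~ s)); c] [::]) lk'.
    by rewrite /c -{2}[s]negbK; exact: reidemeister2.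
  by rewrite ru /= !(drop_size_cat, take_size_cat) //= !drop_size_cat //= take_size_cat.
- have ru' : run (u ++ [:: (i, Cap)]) = Some (l ++ r).
    by rewrite run_cat ru /= drop_size_cat // take_size_cat //; case: (x).
  have lk' : is_link (u ++ [:: (i, Cap), (i, Cup (~~ x)) & nseq m.+1 c] ++ v).
    apply: (@is_link_subst _ _ (nseq m.+2 c)) lk.
    have -> : [:: (i, Cap), (i, Cup (~~ x)) & nseq m.+1 c]
      = [:: (i, Cap)] ++ ((i, Cup (~~ x)) :: nseq m.+1 c) by [].
    rewrite run_from_cat -(run_cat u [:: (i, Cap)]) ru' run_from_cup_cross ?size_cat ?leq_addr //.
    rewrite ru run_from_nseq_cross /= !negbK (negPf em) size_cat leq_addr.
    by rewrite take_size_cat // drop_size_cat //= addbT negbK.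
  rewrite /conway2 -!(cat_rcons (i, Cap) u); congr (map_poly _ _).
  rewrite -cats1.
  rewrite [LHS](conway_cup_cross (m := m.+1) ru') ?size_cat ?leq_addr //=.
    by rewrite em addbT negbK.
  by rewrite -catA.
Qed.

Lemma run_from_twist (l r : level) (x y : bool) (a : int) :
  ~~ odd `|a| ->
  run_from (Some (l ++ [:: x, y & r])) (twist (size l) a)
  = Some (l ++ [:: x, y & r]).
Proof. by move=> ea; rewrite run_from_nseq_cross (negPf ea). Qed.

Lemma conway2_twist4 (u v : diagram) (l r : level) (x : bool) (a : int) :
  run u = Some (l ++ [:: x, ~~ x & r]) -> (4 %| `|a|) -> is_link (u ++ v) ->
  conway2 (u ++ twist (size l) a ++ v) = conway2 (u ++ v).
Proof.
rewrite /twist; move: (0 <= a)%R => s ru /dvdnP[k ->] lk.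
have lkm m : ~~ odd m -> is_link (u ++ nseq m (size l, Cross s) ++ v).
  move=> em; apply: (@is_link_subst _ _ [::]) lk.
  by rewrite ru run_from_nseq_cross (negPf em).
elim: k => [//|k IHk]; rewrite mulSn !addSn add0n.
have e4 : ~~ odd (k * 4) by rewrite oddM andbF.
rewrite !(conway2_full_twist ru) ?IHk /= ?negbK //.
- by rewrite -addrA poly_F2_addrr addr0.
- by apply: (lkm (_.+2)); rewrite /= negbK.
- by apply: (lkm (_.+4)); rewrite /= !negbK.
Qed.

Lemma conway2_twist_regions (u v : diagram) (o b : bool) (a : seq int) :
  run u = Some [:: o; ~~ o; o; ~~ o] -> all (fun x : int => 4 %| `|x|) a ->
  is_link (u ++ v) ->
  conway2 (u ++ twist_regions b a ++ v) = conway2 (u ++ v).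
Proof.
elim: a b u => [//|x a IHa] b u ru /= /andP[x4 a4] lk.
set t := if b then _ else _.
(* The region twists strands 1, 2 or strands 0, 1 according to [b]; both pairs are antiparallel in
   this level. *)
have [l [y [r [Lo [rt tE]]]]] : exists l y r,
    [:: o; ~~ o; o; ~~ o] = l ++ [:: y, ~~ y & r] /\
    run (u ++ t) = run u /\
    forall w, is_link (u ++ w) -> conway2 (u ++ t ++ w) = conway2 (u ++ w).
  have e4 (c : int) : (4 %| `|c|) -> ~~ odd `|c|.
    by case/dvdnP => k ->; rewrite oddM andbF.
  have x4' : (4 %| `|(- x)%R|) by rewrite abszN.
  rewrite /t; case: b {t}.
    exists [:: o], (~~ o), [:: ~~ o]; rewrite negbK; split => //; split.
      by rewrite run_cat ru; exact: (@run_from_twist [:: o] _ _ _ _ (e4 _ x4)).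
    move=> w; apply: (@conway2_twist4 _ _ [:: o] [:: ~~ o] (~~ o)) => //.
    by rewrite negbK.
  exists [::], o, [:: o; ~~ o]; split => //; split.
    by rewrite run_cat ru; exact: (@run_from_twist [::] _ _ _ _ (e4 _ x4')).
  by move=> w; apply: (@conway2_twist4 _ _ [::] [:: o; ~~ o] o).
have lkt : is_link ((u ++ t) ++ v).
  by move: lk; rewrite /is_link run_cat [in X in _ -> X]run_cat rt.
by rewrite -catA catA IHa ?rt // -catA tE.
Qed.

Lemma conway_unknot_bent (o : bool) :
  nabla [:: (0, Cup o); (2, Cup o); (1, Cap); (0, Cap)] = 1%R.
Proof.
rewrite -(conway_unknot nabla_conway o).
by apply: (conway_isotopy nabla_conway (u := [:: (0, Cup o)]) (v := [:: (0, Cap)])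
  (straighten_left 1 o)); case: (o).
Qed.

(** The crossing swings past a maximum onto strands 0, 1, slides down below the second minimum, and
    is then a Reidemeister I kink on the first. *)
Lemma conway_figure_eight (o s : bool) :
  nabla [:: (0, Cup o); (2, Cup (~~ o)); (1, Cross s); (0, Cap); (0, Cap)] = 1%R.
Proof.
transitivity (nabla
  [:: (0, Cup o); (2, Cup (~~ o)); (0, Cross (~~ s)); (1, Cap); (0, Cap)]).
  symmetry; rewrite -{2}[s]negbK.
  by apply: (conway_isotopy nabla_conway (u := [:: (0, Cup o); (2, Cup (~~ o))])
    (v := [:: (0, Cap)]) (swing_cap 0 (~~ s))); case: (o).
transitivity (nabla
  [:: (0, Cup o); (0, Cross (~~ s)); (2, Cup (~~ o)); (1, Cap); (0, Cap)]).
  symmetry; apply: (conway_isotopy nabla_conway (u := [:: (0, Cup o)])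
    (v := [:: (1, Cap); (0, Cap)])
    (exchange_heights 0 0 (Cross (~~ s)) (Cup (~~ o)))); by case: (o).
rewrite -(conway_unknot_bent (~~ o)).
by apply: (conway_isotopy nabla_conway (u := [::])
  (v := [:: (2, Cup (~~ o)); (1, Cap); (0, Cap)])
  (reidemeister1_cup 0 o (~~ s))); case: (o).
Qed.

(** With the circles stacked, a kink is added at the maximum of the second one and removed at its
    minimum, which reverses that circle. *)
Lemma conway_unlink_rev (o1 o2 : bool) :
  nabla [:: (0, Cup o1); (2, Cup o2); (0, Cap); (0, Cap)]
  = nabla [:: (0, Cup o1); (2, Cup (~~ o2)); (0, Cap); (0, Cap)].
Proof.
have stack o : nabla [:: (0, Cup o1); (2, Cup o); (0, Cap); (0, Cap)]
    = nabla [:: (0, Cup o1); (0, Cap); (0, Cup o); (0, Cap)].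
  symmetry; apply: (conway_isotopy nabla_conway (u := [:: (0, Cup o1)])
    (v := [:: (0, Cap)]) (exchange_heights 0 0 Cap (Cup o)));
  by case: (o1); case: (o).
rewrite !stack; transitivity (nabla
  [:: (0, Cup o1); (0, Cap); (0, Cup o2); (0, Cross true); (0, Cap)]).
  symmetry; apply: (conway_isotopy nabla_conway
    (u := [:: (0, Cup o1); (0, Cap); (0, Cup o2)]) (v := [::])
    (reidemeister1_cap 0 true)); by case: (o1); case: (o2).
apply: (conway_isotopy nabla_conway (u := [:: (0, Cup o1); (0, Cap)])
  (v := [:: (0, Cap)]) (reidemeister1_cup 0 o2 true));
by case: (o1); case: (o2).
Qed.

(* The unlink is the oriented smoothing of the crossing of a figure eight,    *)
(* both resolutions of which are unknots.                                     *)
Lemma conway_unlink (o1 o2 : bool) :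
  nabla [:: (0, Cup o1); (2, Cup o2); (0, Cap); (0, Cap)] = 0%R.
Proof.
have opp : nabla [:: (0, Cup o1); (2, Cup (~~ o1)); (0, Cap); (0, Cap)] = 0%R.
  (* For these orientations the middle strands are parallel, so smoothing their crossing just
     deletes it. *)
  have := @conway_skein _ nabla_conway [:: (0, Cup o1); (2, Cup (~~ o1))]
    [:: (0, Cap); (0, Cap)] [:: o1] [:: ~~ ~~ o1] (~~ o1) (~~ o1).
  rewrite /= /smoothing !eqxx !conway_figure_eight subrr.
  move=> /(_ erefl) E; have /esym/eqP : 0%R = ('X * nabla
      [:: (0, Cup o1); (2, Cup (~~ o1)); (0, Cap); (0, Cap)])%R.
    by apply: E; case: (o1).
  by rewrite mulf_eq0 polyX_eq0 => /eqP.
have [->|] := eqVneq o2 (~~ o1); first by [].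
by rewrite conway_unlink_rev; case: (o1) (o2) opp => [] [].
Qed.

End ConwayPolynomial.

Lemma twist_regions_nseq0 (b : bool) (j : nat) :
  twist_regions b (nseq j 0%R) = [::].
Proof. by elim: j b => [//|j IHj] [] /=; rewrite IHj ?oppr0. Qed.

(** The first crossing involves strands 1 and 2, oriented [~~ o1] and [o2]. *)
Lemma antiparallel_rational_link (o1 o2 : bool) (x : int) (a : seq int) :
  x != 0%R -> antiparallel (rational_link o1 o2 (x :: a)) -> o1 = o2.
Proof.
move=> x0 /(_ [:: (0, Cup o1); (2, Cup o2)]).
rewrite /rational_link /= /twist.
case: `|x|%N (absz_eq0 x) => [|m] E; first by move: x0; rewrite -E.
move=> /(_ _ [:: o1] [:: ~~ o2] (~~ o1) o2 _ erefl erefl).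
by case: (o1) (o2) => [] [].
Qed.

Theorem corollary8
  (nabla : diagram -> {poly int}) (nabla_conway : is_conway_polynomial nabla)
  (n : int) (n_mod4 : (n = 0 %[mod 4])%Z) (j : nat) (j_ge1 : 1 <= j)
  (o1 o2 : bool)
  (oriented : is_link (fibonacci_link o1 o2 n j))
  (convention : antiparallel (fibonacci_link o1 o2 n j)) :
  map_poly (intr : int -> 'F_2) (nabla (fibonacci_link o1 o2 n j))
  = (if odd j then 0 else 1)%R.
Proof.
have n4 : 4 %| `|n|.
  by have : (4 %| n)%Z by apply/dvdz_mod0P; rewrite n_mod4 mod0z.
set caps := if odd j then [:: (0, Cap); (0, Cap)] else [:: (1, Cap); (0, Cap)].
pose u := [:: (0, Cup o1); (2, Cup o2)].
have linkE : fibonacci_link o1 o2 n j = u ++ twist_regions true (nseq j n) ++ caps.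
  by rewrite /fibonacci_link /rational_link size_nseq.
have caps_value : is_link (u ++ caps) -> conway2 nabla (u ++ caps)
    = (if odd j then 0 else 1)%R.
  rewrite /conway2 /u /caps; case: (odd j) => /= lk.
    by rewrite conway_unlink // rmorph0.
  (* The cap on the middle strands closes coherently only in this case. *)
  have <- : o1 = o2 by case: (o1) (o2) lk => [] [].
  by rewrite conway_unknot_bent // rmorph1.
rewrite -/(conway2 nabla _) linkE.
(* For [n = 0] there is no crossing to force [o1 = o2], but the diagram is already [u ++ caps]. *)
have [n0|n_neq0] := eqVneq n 0%R.
  by move: oriented; rewrite linkE n0 twist_regions_nseq0; exact: caps_value.
have o12 : o1 = o2.
  by case: j j_ge1 {oriented linkE caps caps_value} convention => // j _;
    exact: antiparallel_rational_link.
have lk : is_link (u ++ caps).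
  by rewrite /u /caps -o12; case: (odd j); case: (o1).
rewrite (@conway2_twist_regions _ _ _ _ o1) ?caps_value //.
  by rewrite /u -o12; case: (o1).
by rewrite all_nseq n4 orbT.
Qed.
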